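(* Let $r,k\in\mathbb N$ with $r>k\geq 2$, let $\delta:=\frac{k!}{2^{k+3}k^2r^{2k-1}}$ and let $n>1/\delta$. Then every $k$-uniform hypergraph $G$ on $n$ vertices with minimum codegree $\delta_{k-1}(G)\geq (1-\delta)n$ has a fractional $K^{(k)}_r$-decomposition.
   Context: $K^{(k)}_r$ denotes the complete $k$-uniform hypergraph on $r$ vertices. For a $k$-uniform hypergraph $G$ and a set $S$ of $k-1$ vertices, $d(S)$ is the number of edges containing $S$; the minimum codegree $\delta_{k-1}(G)$ is the minimum of $d(S)$ over all $(k-1)$-subsets $S$ of $V(G)$. For a $k$-uniform hypergraph $F$, with $\mathcal F(G)$ the set of copies of $F$ in $G$, a fractional $F$-decomposition of $G$ is a function $\omega:\mathcal F(G)\to[0,1]$ such that for every edge $e\in E(G)$, $\sum_{F'\in\mathcal F(G):\,e\in E(F')}\omega(F')=1$. *)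

(* Defs.v *)
From HB Require Import structures.
From mathcomp Require Import all_boot all_order all_algebra.

Set Implicit Arguments.
Unset Strict Implicit.
Unset Printing Implicit Defensive.

Import Order.TTheory GRing.Theory Num.Theory.

Local Open Scope ring_scope.

Record uhypergraph (k : nat) := UHypergraph {
  vertex : finType;
  edges : {set {set vertex}};
  edges_uniform : {in edges, forall e : {set vertex}, #|e| = k} }.

Lemma complete_uniform (k r : nat) :
  {in [set e : {set 'I_r} | #|e| == k], forall e : {set 'I_r}, #|e| = k}.
Proof. by move=> e; rewrite inE => /eqP. Qed.

Definition complete (k r : nat) : uhypergraph k :=
  UHypergraph (@complete_uniform k r).

Definition codegree (k : nat) (G : uhypergraph k) (S : {set vertex G}) : nat :=
  #|[set e : {set vertex G} in edges G | S \subset e]|.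

(* For 0 < k the codegree of a (k-1)-set is at most #|vertex G|, so the default
   value of the iterated minimum only matters when there is no (k-1)-set. *)
Definition min_codegree (k : nat) (G : uhypergraph k) : nat :=
  \big[minn/#|vertex G|]_(S : {set vertex G} | #|S| == k.-1) codegree S.

(* A copy of F in G is a subhypergraph of G isomorphic to F, given as the pair
   of its vertex set and its edge set, so that embeddings with the same image
   yield the same copy. *)
Definition copies (k : nat) (F G : uhypergraph k) :
    {set {set vertex G} * {set {set vertex G}}} :=
  [set H : {set vertex G} * {set {set vertex G}} | (H.2 \subset edges G) &&
    [exists f : {ffun vertex F -> vertex G},
      [&& injectiveb f, H.1 == [set f x | x : vertex F]
        & H.2 == [set [set f x | x in e] | e : {set vertex F} in edges F]]]].

(* Only the values of w on copies F G are relevant. *)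
Definition fractional_decomposition (R : numDomainType) (k : nat)
    (F G : uhypergraph k)
    (w : {set vertex G} * {set {set vertex G}} -> R) : Prop :=
  {in copies F G, forall H : {set vertex G} * {set {set vertex G}}, 0 <= w H <= 1} /\
  {in edges G, forall e : {set vertex G},
    \sum_(H in copies F G | e \in H.2) w H = 1}.

(* Main.v *)
(** Give every [r]-clique the weight [1 / A], where [A] is the number of
    [(r - k)]-cliques.  An edge [e] then misses weight [bad e / A], where [bad e]
    counts the [(r - k)]-cliques that do not extend [e] to an [r]-clique.
    Comparing with [A], rather than with the number of all sets of [r - k]
    vertices, keeps [bad e] small: only non-edges meeting [e] contribute.
    Inside an [(r + k)]-clique [Q] containing [e] there is a signed weighting of
    the [r]-subsets [K], depending on [#|e :\: K|] only, that puts total weight 1 on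
    [e] and 0 on every other edge.  Averaging it over all such [Q] corrects the
    weight of [e] alone, and the sum of all the corrections on a given [K] is at
    most [1 / A] in absolute value. *)
Require Import Defs.
From mathcomp Require Import all_boot all_order all_algebra.
From mathcomp Require Import reals.
From mathcomp Require Import zify ring lra.

Set Implicit Arguments.
Unset Strict Implicit.
Unset Printing Implicit Defensive.

Import Order.TTheory GRing.Theory Num.Theory.

Local Open Scope ring_scope.

(** * Elementary estimates and an identity for binomial coefficients *)

Lemma leq_ffact_expn (n t : nat) : (n ^_ t <= n ^ t)%N.
Proof.
by elim: t => [|t IHt] //; rewrite ffactnSr expnSr leq_mul // leq_subr.
Qed.

Lemma leq_fact_mul_bin (n t : nat) : (t`! * 'C(n, t) <= n ^ t)%N.
Proof. by rewrite mulnC bin_ffact leq_ffact_expn. Qed.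

Lemma leq_bin_expn (n t : nat) : ('C(n, t) <= n ^ t)%N.
Proof.
by apply: leq_trans (leq_fact_mul_bin n t); rewrite leq_pmull ?fact_gt0.
Qed.

Lemma leq_minn_big (I : finType) (P : pred I) (F : I -> nat) (d : nat) (i : I) :
  P i -> (\big[minn/d]_(j | P j) F j <= F i)%N.
Proof.
move=> Pi; have: i \in index_enum I by rewrite mem_index_enum.
elim: (index_enum I) => // j s IHs; rewrite inE big_cons.
case/orP=> [/eqP <-|i_s]; first by rewrite Pi geq_minl.
by case: ifP => _; [apply: leq_trans (geq_minr _ _) _ |]; apply: IHs.
Qed.

(** Both products count the ordered pairs of disjoint subsets of sizes [a] and [b] in an [n]-set. *)
Lemma bin_trade (n a b : nat) :
  ('C(n, a) * 'C(n - a, b) = 'C(n, b) * 'C(n - b, a))%N.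
Proof.
case: (leqP (a + b) n) => [le_abn|lt_nab].
  have fE c d : (c + d <= n)%N ->
      ('C(n, c) * 'C(n - c, d) * (c`! * d`! * (n - c - d)`!) = n`!)%N.
    move=> le_cd; have le_cn : (c <= n)%N by lia.
    have le_dn : (d <= n - c)%N by lia.
    rewrite -(bin_fact le_cn) -(bin_fact le_dn); ring.
  apply/eqP; rewrite -(eqn_pmul2r (m := a`! * b`! * (n - a - b)`!)%N); last first.
    by rewrite !muln_gt0 !fact_gt0.
  by rewrite fE // (mulnC a`!) subnAC fE // addnC.
case: (leqP a n) => [le_an|lt_na]; last first.
  by rewrite (bin_small lt_na) mul0n (@bin_small (n - b) a) ?muln0 //; lia.
rewrite (@bin_small (n - a) b) ?muln0; last lia.
case: (leqP b n) => [le_bn|lt_nb]; last by rewrite (bin_small lt_nb).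
by rewrite (@bin_small (n - b) a) ?muln0 //; lia.
Qed.

(** * Counting and summing over subsets of a finite set *)

Section FiniteSets.

Variable T : finType.
Implicit Types A B L X Y Z : {set T}.

(** Double count of the pairs [v \in A] with [A \in F], each recorded through [Z = A :\ v]. It
    drives the inductions that grow cliques by one vertex. *)
Lemma card_pairs (F : {set {set T}}) (t : nat) :
  {in F, forall A, #|A| = t.+1} ->
  (t.+1 * #|F| = \sum_(Z : {set T} | #|Z| == t) #|[set v | v \notin Z & v |: Z \in F]|)%N.
Proof.
move=> F_card.
have -> : (t.+1 * #|F| = \sum_(A in F) \sum_(v in A) 1)%N.
  rewrite mulnC -sum_nat_const; apply: eq_bigr => A FA.
  by rewrite sum1_card F_card.
under [RHS]eq_bigr do rewrite -sum1_card.
rewrite (exchange_big_dep predT) //= [RHS](exchange_big_dep predT) //=.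
apply: eq_bigr => v _.
rewrite (reindex_onto (fun Z => v |: Z) (fun A => A :\ v)) /=; last first.
  by move=> A /andP[_ vA]; rewrite setD1K.
apply: eq_bigl => Z; rewrite !inE eqxx andbT /=.
case: (boolP (v \in Z)) => [vZ|vZ] /=.
  rewrite andbF; apply/negbTE; rewrite negb_and; apply/orP; right.
  by apply/eqP => /setP /(_ v); rewrite !inE eqxx vZ.
rewrite setU1K // eqxx andbT; case: (boolP (_ \in F)) => [FZ|_]; last by rewrite andbF.
by move: (F_card _ FZ); rewrite cardsU1 vZ add1n => -[->]; rewrite eqxx.
Qed.

Lemma card_supsets A (t : nat) :
  #|[set B : {set T} | A \subset B & #|B| == (#|A| + t)%N]| = 'C(#|T| - #|A|, t).
Proof.
have <- : #|~: A| = (#|T| - #|A|)%N by rewrite -(cardsC A) addKn.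
rewrite -cards_draws -sum1_card -[RHS]sum1_card.
rewrite (reindex_onto (fun Z => A :|: Z) (fun B => B :\: A)) /=; last first.
  by move=> B; rewrite inE => /andP[/setUidPr AB _]; rewrite setDE setUIr AB setUCr setIT.
apply: eq_bigl => Z; rewrite !inE subsetUl /= setDUl setDv set0U.
case: (boolP (Z \subset ~: A)) => ZA /=.
  have AZ0 : A :&: Z = set0 by apply/eqP; rewrite setI_eq0 disjoint_sym disjoints_subset.
  have ->: Z :\: A = Z by apply/setDidPl; rewrite disjoints_subset.
  by rewrite cardsU AZ0 cards0 subn0 eqxx andbT eqn_add2l.
apply/negbTE; rewrite negb_and; apply/orP; right.
by apply: contra ZA => /eqP <-; rewrite setDE subsetIr.
Qed.

Lemma fact_mul_card_supsets_le A (t : nat) (F : {set {set T}}) :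
  {in F, forall B, A \subset B /\ #|B| = (#|A| + t)%N} ->
  (t`! * #|F| <= #|T| ^ t)%N.
Proof.
move=> HF; apply: leq_trans (leq_fact_mul_bin _ _); rewrite leq_mul2l.
apply/orP; right; apply: leq_trans (leq_bin2l t (leq_subr #|A| _)).
rewrite -card_supsets; apply/subset_leq_card/subsetP => B /HF [AB /eqP cB].
by rewrite inE AB.
Qed.

(** Group the sets [L] by their trace [A] on [X]; the rest of [L] is any [(k - #|A|)]-subset of [Y].
    The bound on [#|X|] keeps [k - #|A|] from being truncated. *)
Lemma sum_ksubsets_setU (R : nzRingType) X Y (k : nat) (f : nat -> R) :
  [disjoint X & Y] -> (#|X| <= k)%N ->
  \sum_(L : {set T} | (L \subset X :|: Y) && (#|L| == k)) f #|L :&: X| =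
  \sum_(A : {set T} | A \subset X) f #|A| * 'C(#|Y|, k - #|A|)%:R.
Proof.
move=> XY le_Xk.
rewrite (partition_big (fun L => L :&: X) (fun A => A \subset X)) /=; last first.
  by move=> L _; apply: subsetIr.
apply: eq_bigr => A AX.
have le_Ak : (#|A| <= k)%N by apply: leq_trans le_Xk; apply: subset_leq_card.
rewrite -cards_draws mulr_natr -sumr_const.
have XY0 : X :&: Y = set0 by apply/eqP; rewrite setI_eq0.
rewrite (reindex_onto (fun Z => A :|: Z) (fun L => L :\: X)) /=; last first.
  by move=> L /andP[_ /eqP <-]; rewrite setUC setDE -setIUr setUC setUCr setIT.
apply: eq_big => [Z|Z /andP[/andP[_ /eqP ->]] //].
rewrite !inE; case: (boolP (Z \subset Y)) => ZY /=.
  have ZX0 : Z :&: X = set0.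
    by apply/eqP; rewrite -subset0 setIC -XY0; apply: setIS.
  have AZ0 : A :&: Z = set0.
    by apply/eqP; rewrite -subset0 -ZX0 setIC; apply: setIS.
  have -> : (A :|: Z) :&: X = A by rewrite setIUl ZX0 setU0; apply/setIidPl.
  have -> : (A :|: Z) :\: X = Z.
    rewrite setDUl (_ : A :\: X = set0) ?set0U; last by apply/eqP; rewrite setD_eq0.
    by apply/setDidPl; rewrite -setI_eq0 ZX0.
  rewrite !eqxx !andbT setUSS //= cardsU AZ0 cards0 subn0.
  by apply/eqP/eqP; lia.
apply/negbTE; apply: contra ZY => /andP[/andP[/andP[AZ _] _] /eqP <-].
apply/subsetP => z; rewrite inE => /andP[zX zAZ].
by move/subsetP/(_ z zAZ): AZ; rewrite inE (negPf zX).
Qed.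

Lemma sum_subsets_insert (R : nzRingType) X (u : T) (f : {set T} -> R) : u \notin X ->
  \sum_(A : {set T} | A \subset u |: X) f A =
  \sum_(A : {set T} | A \subset X) f A + \sum_(A : {set T} | A \subset X) f (u |: A).
Proof.
move=> uX; rewrite (bigID (fun A : {set T} => u \in A)) /= addrC; congr (_ + _).
  apply: eq_bigl => A; apply/andP/idP => [[AX uA]|AX].
    apply/subsetP => z zA; move/subsetP/(_ z zA): AX; rewrite !inE.
    by case/orP => // /eqP zu; rewrite zu (negPf uA) in zA *.
  split; first by apply: subset_trans AX _; apply: subsetUr.
  by apply: contra uX; apply: (subsetP AX).
rewrite (reindex_onto (fun A => u |: A) (fun A => A :\ u)) /=; last first.
  by move=> A /andP[_ uA]; rewrite setD1K.
apply: eq_bigl => A; rewrite setU11 andbT.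
case: (boolP (u \in A)) => uA.
  rewrite (_ : _ \subset X = false); last first.
    by apply/negbTE; apply: contra uX => /subsetP/(_ u uA).
  by rewrite andbC; apply/negbTE/nandP; left; apply/eqP => /setP/(_ u); rewrite !inE eqxx uA.
rewrite setU1K // eqxx andbT; apply/idP/idP => [|AX]; last exact: setUS.
move/subsetP => AX; apply/subsetP => z zA; have := AX z; rewrite !inE zA orbT => /(_ isT).
by case/orP => // /eqP zu; rewrite zu (negPf uA) in zA.
Qed.

(* The [#|X|]-th finite difference of a polynomial of degree [p < #|X|]. *)
Lemma alternating_sum_bin (R : nzRingType) X (x p : nat) : (p < #|X|)%N ->
  \sum_(A : {set T} | A \subset X) (-1) ^+ #|A| * 'C(x + #|A|, p)%:R = 0 :> R.
Proof.
move eq_m: #|X| => m; elim: m => // m IHm in X p x eq_m *; rewrite ltnS => le_pm.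
have [u uX] : exists u, u \in X by apply/set0Pn; rewrite -card_gt0 eq_m.
have cX : #|X :\ u| = m by move: eq_m; rewrite (cardsD1 u) uX => -[].
rewrite -(setD1K uX) sum_subsets_insert ?setD11 // -big_split /=.
(* Pairing [A] with [u |: A] replaces the binomial, up to sign, by its first difference, which is
   zero for [p = 0] and otherwise, by Pascal's rule, a binomial with lower index [p - 1]. *)
have stepE A : A \subset X :\ u ->
    (-1) ^+ #|A| * 'C(x + #|A|, p)%:R + (-1) ^+ #|u |: A| * 'C(x + #|u |: A|, p)%:R
    = - ((-1) ^+ #|A| * ('C((x + #|A|).+1, p)%:R - 'C(x + #|A|, p)%:R)) :> R.
  move=> /subsetP AX; have uA : u \notin A by apply/negP => /AX; rewrite setD11.
  by rewrite cardsU1 uA add1n addnS exprS mulN1r mulNr -mulrBr -mulrN opprB.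
rewrite (eq_bigr _ stepE) sumrN.
case: p le_pm {stepE} => [|p] le_pm.
  by rewrite big1 ?oppr0 // => A _; rewrite !bin0 subrr mulr0.
under eq_bigr do rewrite binS natrD addrAC subrr add0r.
by rewrite IHm ?oppr0.
Qed.

End FiniteSets.

(** * The signed weighting inside one [(r + k)]-set *)

(* The weight of an [r]-subset [K] of an [(r + k)]-clique containing the edge [e],
   where [l = #|e :\: K|].  The binomial in the denominator turns the total weight
   on another edge into a finite difference of order higher than the degree. *)
Definition gadget_coef (R : fieldType) (r k l : nat) : R :=
  (-1) ^+ l * (r - k)%:R / (r%:R * 'C(r.-1, k - l)%:R).

(** With [j = k - l], the identity [r * 'C(r.-1, j) = (r - j) * 'C(r, j)] turns the absolute value
    into [(r - k) / (r - j)] times the bound, and [j <= k]. *)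
Lemma norm_gadget_coef (R : realFieldType) (r k l : nat) : (k < r)%N ->
  `|gadget_coef R r k l| <= ('C(r, k - l)%:R)^-1.
Proof.
move=> lt_kr; rewrite /gadget_coef -natrM mul_bin_down normrM normrM normrX normrN1.
rewrite expr1n mul1r normfV !normr_nat natrM invfM mulrA ler_piMl //.
  by rewrite invr_ge0 ler0n.
rewrite ler_pdivrMr ?mul1r ?ler_nat ?ltr0n; lia.
Qed.

(** Complements [L] in [Q] of the sets [K] through [f] are the [k]-subsets of [Q :\: f], and
    [e :\: K] becomes [L :&: (e :\: f)]. Group by this trace: for [e = f] only the empty trace
    occurs and the normalisation gives 1; otherwise an alternating sum over the subsets of [e :\: f]
    vanishes. *)
Lemma sum_gadget_coef (R : numFieldType) (T : finType) (r k : nat) (Q e f : {set T}) :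
  (k < r)%N -> e \subset Q -> f \subset Q -> #|e| = k -> #|f| = k -> #|Q| = (r + k)%N ->
  \sum_(K : {set T} | [&& f \subset K, K \subset Q & #|K| == r]) gadget_coef R r k #|e :\: K|
  = (e == f)%:R.
Proof.
move=> lt_kr eQ fQ ce cf cQ.
have QfE : Q :\: f = (e :\: f) :|: (Q :\: (e :|: f)).
  apply/setP => z; rewrite !inE; move/subsetP/(_ z): eQ.
  by case: (z \in e); case: (z \in Q); case: (z \in f) => //= /(_ isT).
have XY : [disjoint e :\: f & Q :\: (e :|: f)].
  by rewrite -setI_eq0; apply/eqP/setP => z; rewrite !inE; case: (z \in e); rewrite ?andbF.
have le_m : (#|e :\: f| <= k)%N by rewrite -ce subset_leq_card // subsetDl.
have cY : #|Q :\: (e :|: f)| = (r - #|e :\: f|)%N.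
  have := cardsU (e :\: f) (Q :\: (e :|: f)); rewrite -QfE.
  move: XY; rewrite -setI_eq0 => /eqP ->; rewrite cards0 subn0.
  rewrite cardsD (setIidPr fQ) cQ cf; lia.
rewrite (reindex_onto (fun L => Q :\: L) (fun K => Q :\: K)) /=; last first.
  by move=> K /and3P[_ KQ _]; rewrite setDDr setDv set0U; apply/setIidPr.
rewrite (eq_bigl (fun L : {set T} => (L \subset (e :\: f) :|: (Q :\: (e :|: f))) && (#|L| == k)));
  last first.
  move=> L; rewrite -QfE subsetDl /= setDDr setDv set0U.
  case: (boolP (L \subset Q :\: f)) => [|LQf] /=.
    rewrite subsetD => /andP[LQ Lf].
    rewrite subsetD fQ disjoint_sym Lf /= (setIidPr LQ) eqxx andbT.
    rewrite cardsD (setIidPr LQ) cQ; move/subset_leq_card: LQ; rewrite cQ.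
    by move=> ?; apply/idP/idP; lia.
  apply/negbTE; apply: contra LQf => /andP[/andP[fL _] /eqP LQ].
  rewrite subsetD -{1}LQ subsetIl /=; move: fL; rewrite subsetD disjoint_sym => /andP[_].
  done.
rewrite (eq_bigr (fun L => gadget_coef R r k #|L :&: (e :\: f)|)); last first.
  move=> L /andP[LQ _]; congr (gadget_coef _ _ _ #|pred_of_set _|); apply/setP => z.
  move/subsetP/(_ z): LQ; move/subsetP/(_ z): eQ; move/subsetP/(_ z): fQ; rewrite !inE.
  by case: (z \in L); case: (z \in e); case: (z \in f); case: (z \in Q) => //= H1 H2 H3;
    first [by have := H1 isT | by have := H2 isT | by have := H3 isT].
rewrite (sum_ksubsets_setU _ XY le_m) cY.
case: eqP => [->|/eqP neq_ef].
  rewrite setDv (big_pred1 set0) => [|A]; last by rewrite subset0.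
  rewrite cards0 /gadget_coef !subn0 expr0 mul1r mulrAC -!natrM -mul_bin_down divff //.
  by rewrite lt0r_neq0 // ltr0n muln_gt0 bin_gt0; lia.
have m_gt0 : (0 < #|e :\: f|)%N.
  rewrite card_gt0 setD_eq0; apply: contra neq_ef => ef.
  by rewrite eqEcard ef ce cf /=.
set m := #|e :\: f| in le_m cY m_gt0 *.
(* By [bin_trade] the quotient of binomials is a constant times a polynomial in [l = #|A|] of degree
   [m - 1], too low to survive the alternating sum over the subsets of an [m]-set. *)
have termE (A : {set T}) : A \subset e :\: f ->
    gadget_coef R r k #|A| * 'C(r - m, k - #|A|)%:R =
    (r - k)%:R / (r%:R * 'C(r.-1, m.-1)%:R) *
    ((-1) ^+ #|A| * 'C(r.-1 - k + #|A|, m.-1)%:R).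
  move=> /subset_leq_card; rewrite -/m; move: #|A| => l le_lm.
  have := bin_trade r.-1 (k - l) m.-1.
  rewrite (_ : r.-1 - (k - l) = r.-1 - k + l)%N; last lia.
  rewrite (_ : r.-1 - m.-1 = r - m)%N; last lia.
  move/(congr1 (GRing.natmul (1 : R))); rewrite !natrM => tradeE.
  have C1 : 'C(r.-1, k - l)%:R != 0 :> R by rewrite pnatr_eq0 -lt0n bin_gt0; lia.
  have C2 : 'C(r.-1, m.-1)%:R != 0 :> R by rewrite pnatr_eq0 -lt0n bin_gt0; lia.
  have r0 : r%:R != 0 :> R by rewrite pnatr_eq0; lia.
  have -> : 'C(r - m, k - l)%:R =
      'C(r.-1, k - l)%:R * 'C(r.-1 - k + l, m.-1)%:R / 'C(r.-1, m.-1)%:R :> R.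
    by rewrite tradeE mulrAC divff ?mul1r.
  rewrite /gadget_coef; field.
  by rewrite r0 C1 C2.
rewrite (eq_bigr _ termE) -mulr_sumr alternating_sum_bin ?mulr0 //.
by rewrite -/m; lia.
Qed.

(** Group the sets [e] by their trace [A] on the [k]-set [Q :\: K]. There are ['C(r, k - #|A|)] of
    them, which cancels the bound of [norm_gadget_coef], so each of the [2 ^ k] traces contributes
    at most 1. *)
Lemma sum_norm_gadget_coef (R : realFieldType) (T : finType) (r k : nat) (Q K : {set T}) :
  (k < r)%N -> K \subset Q -> #|K| = r -> #|Q| = (r + k)%N ->
  \sum_(e : {set T} | (e \subset Q) && (#|e| == k)) `|gadget_coef R r k #|e :\: K| | <= 2 ^+ k.
Proof.
move=> lt_kr KQ cK cQ.
have cD : #|Q :\: K| = k by rewrite cardsD (setIidPr KQ) cQ cK addKn.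
have dis : [disjoint Q :\: K & K].
  by rewrite -setI_eq0 setDE -setIA (setIC _ K) setICr setI0.
have QE : Q = (Q :\: K) :|: K.
  by rewrite setDE setUIl (setUC (~: K)) setUCr setIT; apply/esym/setUidPl.
have -> : 2 ^+ k = \sum_(e : {set T} | (e \subset Q) && (#|e| == k))
    ('C(r, k - #|e :&: (Q :\: K)|)%:R)^-1 :> R.
  rewrite {1}QE (@sum_ksubsets_setU _ _ _ _ _ (fun l => ('C(r, k - l)%:R)^-1)) //; last first.
    by rewrite cD.
  rewrite (eq_bigr (fun=> 1)); last first.
    by move=> A _; rewrite cK mulVf // pnatr_eq0 -lt0n bin_gt0; lia.
  rewrite -natrX -cD -card_powerset sumr_const; congr (_%:R).
  by apply: eq_card => A; rewrite !inE.
apply: ler_sum => e /andP[eQ _]; rewrite setIDA (setIidPl eQ).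
exact: norm_gadget_coef.
Qed.

(** * Counting the sets that do or do not extend a given clique *)

Section CliqueCounting.

Variables (R : realFieldType) (T : finType) (E : {set {set T}}) (k : nat).
Implicit Types e F P Q S Y Z : {set T}.

(** A set with fewer than [k] elements is vacuously a clique. *)
Definition clique P := [forall F : {set T}, (F \subset P) && (#|F| == k) ==> (F \in E)].

Lemma cliqueP P :
  reflect (forall F, F \subset P -> #|F| = k -> F \in E) (clique P).
Proof.
apply: (iffP forallP) => [H F FP /eqP cF|H F]; first by have:= H F; rewrite FP cF.
by apply/implyP => /andP[FP /eqP]; apply: H.
Qed.

Lemma sub_clique P Q : P \subset Q -> clique Q -> clique P.
Proof.
move=> PQ /cliqueP cQ; apply/cliqueP => F FP; apply: cQ; exact: subset_trans PQ.
Qed.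

Definition extends e Z := [disjoint e & Z] && clique (e :|: Z).

Definition extensions e (t : nat) : {set {set T}} := [set Z : {set T} | (#|Z| == t) && extends e Z].

Definition nonextensions e (t : nat) : {set {set T}} :=
  [set Z : {set T} | [&& #|Z| == t, clique Z & ~~ extends e Z]].

Lemma card_extensions e (t : nat) :
  #|extensions e t| = #|[set K : {set T} | [&& clique K, e \subset K & #|K| == (#|e| + t)%N]]|.
Proof.
rewrite -[LHS]sum1_card -[RHS]sum1_card.
rewrite [RHS](reindex_onto (fun Z : {set T} => e :|: Z) (fun K : {set T} => K :\: e)) /=; last first.
  by move=> K; rewrite inE => /and3P[_ /setUidPr eK _]; rewrite setDE setUIr eK setUCr setIT.
apply: eq_bigl => Z; rewrite !inE /extends subsetUl /= setDUl setDv set0U.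
have -> : (Z :\: e == Z) = [disjoint e & Z].
  by apply/eqP/idP => [<-|dis]; [rewrite -setI_eq0 setDE setICA setICr setI0
    | apply/setDidPl; rewrite disjoint_sym].
case: (boolP [disjoint e & Z]) => [dis|]; last by rewrite !andbF.
move: dis; rewrite -setI_eq0 andbT => /eqP dis.
by rewrite cardsU dis cards0 subn0 eqn_add2l andbC.
Qed.

Lemma card_cliques e (t : nat) :
  #|[set Z : {set T} | (#|Z| == t) && clique Z]| = (#|extensions e t| + #|nonextensions e t|)%N.
Proof.
rewrite -(cardsID [set Z : {set T} | extends e Z] [set Z : {set T} | (#|Z| == t) && clique Z]).
congr (_ + _)%N; apply: eq_card => Z; rewrite !inE.
  case: (boolP (extends e Z)) => ext; rewrite ?andbF // !andbT.
  case/andP: ext => _ /(sub_clique (subsetUr e Z)) ->; exact: andbT.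
by rewrite andbC andbA.
Qed.

Lemma fact_mul_card_extensions_le e (t : nat) : (t`! * #|extensions e t| <= #|T| ^ t)%N.
Proof.
apply: (@fact_mul_card_supsets_le _ set0) => Z; rewrite inE => /andP[/eqP <- _].
by rewrite sub0set cards0.
Qed.

(** For a [(k-1)]-set [S] in a [k]-uniform [E] this includes the members of [S], as [v |: S = S] is
    then no edge; the count is thus exactly the number of vertices minus the codegree. *)
Definition nonneighbours S := [set v : T | v |: S \notin E].

(* Vertices that extend the part of the clique [P] outside [Y], but not [P] itself.
   Taking [Y = P] gives all the vertices that do not extend [P]. *)
Definition blocked P Y := [set v : T | [&& v \notin P :\: Y, clique (v |: (P :\: Y))
  & ~~ ((v \notin P) && clique (v |: P))]].

Hypothesis k_ge2 : (2 <= k)%N.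
Hypothesis E_uniform : {in E, forall e, #|e| = k}.

Variable d : R.
Hypothesis d_ge0 : 0 <= d.
Hypothesis few_nonneighbours :
  forall S, #|S| = k.-1 -> #|nonneighbours S|%:R <= d * #|T|%:R.

(** If [v] lies in [Y], any [(k-1)]-subset of [Y] through [v] serves as [S]. If [v] lies outside
    [P], some non-edge [F] in [v |: P] contains [v], since [P] is a clique, and [F :\ v] meets [Y],
    since [v |: (P :\: Y)] is a clique. *)
Lemma blocked_nonneighbour P Y v :
  clique P -> Y \subset P -> (k.-1 <= #|Y|)%N -> v \in blocked P Y ->
  exists S, [/\ S \subset P, #|S| = k.-1, ~~ [disjoint Y & S] & v \in nonneighbours S].
Proof.
move=> cP YP kY; rewrite inE => /and3P[vPY clPY]; case: (boolP (v \in P)) => vP /=.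
  have vY : v \in Y by move: vPY; rewrite inE vP andbT negbK.
  move=> _.
  have : (0 < #|[set A : {set T} | A \subset Y :\ v & #|A| == k.-2]|)%N.
    by rewrite cards_draws bin_gt0; move: kY; rewrite (cardsD1 v) vY; lia.
  case/card_gt0P => A; rewrite inE => /andP[AY /eqP cA]; exists (v |: A); split.
  - rewrite subUset sub1set vP (subset_trans AY) //.
    by apply: subset_trans YP; apply: subsetDl.
  - rewrite cardsU1 cA (_ : v \notin A); first by lia.
    by apply/negP => /(subsetP AY); rewrite setD11.
  - by apply/pred0Pn; exists v; rewrite /= vY setU11.
  rewrite inE setUA setUid; apply/negP => /E_uniform; rewrite cardsU1 cA.
  by case: (v \in A) => /=; lia.
rewrite negb_forall => /existsP[F]; rewrite negb_imply => /andP[/andP[Fs /eqP cF] FE].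
have vF : v \in F.
  apply: contraR FE => vF; move/cliqueP: cP; apply => //.
  apply/subsetP => z zF; have := subsetP Fs z zF; rewrite !inE => /orP[/eqP zv|//].
  by rewrite -zv zF in vF.
exists (F :\ v); split.
- by rewrite subDset.
- by rewrite -cF (cardsD1 v F) vF.
- apply: contra FE => dis; move/cliqueP: clPY; apply => //.
  apply/subsetP => z zF; have := subsetP Fs z zF; rewrite !inE.
  case: eqP => //= /eqP zv ->; rewrite andbT; apply/negP => zY.
  by case/pred0P/(_ z)/negP: dis; rewrite /= !inE zY zF zv.
by rewrite inE setD1K.
Qed.

(** Choose an element of [Y] in [S], then the other [k - 2] elements from [P]. *)
Lemma card_meeting_ksubsets_le P Y :
  (#|[set S : {set T} | [&& S \subset P, #|S| == k.-1 & ~~ [disjoint Y & S]]]|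
     <= #|Y| * #|P| ^ k.-2)%N.
Proof.
pose F u := (fun A => u |: A) @: [set A : {set T} | A \subset P & #|A| == k.-2].
have sub : [set S : {set T} | [&& S \subset P, #|S| == k.-1 & ~~ [disjoint Y & S]]]
    \subset \bigcup_(u in Y) F u.
  apply/subsetP => S; rewrite inE => /and3P[SP /eqP cS /pred0Pn[u /andP[uY uS]]].
  apply/bigcupP; exists u => //; apply/imsetP; exists (S :\ u); last by rewrite setD1K.
  rewrite inE (subset_trans _ SP) ?subsetDl //=; apply/eqP.
  by move: cS; rewrite (cardsD1 u S) [u \in S]uS; lia.
apply: leq_trans (subset_leq_card sub) _.
have cF u : (#|F u| <= #|P| ^ k.-2)%N.
  by apply: leq_trans (leq_imset_card _ _) _; rewrite cards_draws leq_bin_expn.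
rewrite -sum_nat_const.
elim/big_rec2: _ => [|u m B _ IH]; first by rewrite cards0.
by apply: leq_trans (leq_card_setU _ _) _; rewrite leq_add.
Qed.

Lemma card_blocked P Y : clique P -> Y \subset P -> (k.-1 <= #|Y|)%N ->
  #|blocked P Y|%:R <= (#|Y| * #|P| ^ k.-2)%:R * d * #|T|%:R.
Proof.
move=> cP YP kY.
pose SS := [set S : {set T} | [&& S \subset P, #|S| == k.-1 & ~~ [disjoint Y & S]]].
have sub : blocked P Y \subset \bigcup_(S in SS) nonneighbours S.
  apply/subsetP => v /(blocked_nonneighbour cP YP kY)[S [SP cS YS vS]].
  by apply/bigcupP; exists S => //; rewrite inE SP cS eqxx.
apply: (@le_trans _ _ (#|SS|%:R * (d * #|T|%:R))); last first.
  by rewrite -mulrA ler_wpM2r ?mulr_ge0 ?ler0n // ler_nat card_meeting_ksubsets_le.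
apply: (@le_trans _ _ #|\bigcup_(S in SS) nonneighbours S|%:R).
  by rewrite ler_nat subset_leq_card.
rewrite mulr_natl -[leRHS]sumr_const.
apply: (big_rec2 (fun (B : {set T}) (x : R) => #|B|%:R <= x)); first by rewrite cards0.
move=> S B x; rewrite inE => /and3P[_ /eqP cS _] IH.
apply: (@le_trans _ _ (#|nonneighbours S| + #|B|)%:R).
  by rewrite ler_nat leq_card_setU.
by rewrite natrD lerD // few_nonneighbours.
Qed.

(* Adjoining vertices one at a time loses a fraction [b * d] at each step. *)
Lemma card_extensions_ge e (t : nat) (b : R) : 0 <= b -> b * d <= 1 ->
  clique e -> (k.-1 <= #|e|)%N -> ((#|e| + t) ^ k.-1)%:R <= b ->
  #|T|%:R ^+ t * (1 - t%:R * (b * d)) <= t`!%:R * #|extensions e t|%:R.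
Proof.
move=> b0 bd1 cle ke.
elim: t => [|t IHt] bt.
  rewrite !mul0r subr0 expr0 !mul1r ler1n card_gt0; apply/set0Pn; exists set0.
  by rewrite inE cards0 /extends setU0 cle -setI_eq0 setI0 !eqxx.
have {}IHt : #|T|%:R ^+ t * (1 - t%:R * (b * d)) <= t`!%:R * #|extensions e t|%:R.
  by apply: IHt; apply: le_trans bt; rewrite ler_nat leq_exp2r; lia.
have stepE : #|extensions e t|%:R * (#|T|%:R * (1 - b * d)) <= (t.+1 * #|extensions e t.+1|)%:R.
  rewrite (@card_pairs _ _ t); last by move=> A; rewrite inE => /andP[/eqP].
  apply: (@le_trans _ _ (\sum_(Z in extensions e t)
      #|[set v | v \notin Z & v |: Z \in extensions e t.+1]|)%:R); last first.
    rewrite ler_nat [leqRHS](bigID (fun Z : {set T} => Z \in extensions e t)) /=.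
    apply: leq_trans (leq_addr _ _); rewrite leq_eqVlt; apply/orP; left; apply/eqP.
    by apply: eq_bigl => Z; rewrite inE; case: (#|Z| == t).
  rewrite mulr_natl -[leLHS]sumr_const natr_sum; apply: ler_sum => Z.
  rewrite inE => /andP[/eqP cZ /andP[dis cl]].
  have cU : #|e :|: Z| = (#|e| + t)%N.
    by move: dis; rewrite cardsU cZ -setI_eq0 => /eqP ->; rewrite cards0 subn0.
  have := card_blocked cl (subxx _).
  rewrite cU => /(_ ltac:(lia)).
  have cC : (#|T| <= #|[set v | v \notin Z & v |: Z \in extensions e t.+1]|
      + #|blocked (e :|: Z) (e :|: Z)|)%N.
    rewrite -cardsT; apply: leq_trans (leq_card_setU _ _).
    apply/subset_leq_card/subsetP => v _; rewrite inE orbC; apply/orP.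
    case: (boolP (v \in blocked _ _)) => vb; [by left | right].
    move: vb; rewrite /blocked setDv !inE /= setU0 negb_and negbK.
    case/orP.
      (* A single vertex is vacuously a clique, because [2 <= k]. *)
      case/negP; apply/cliqueP => F Fv cF; exfalso.
      by move/subset_leq_card: Fv; rewrite cards1 cF; lia.
    rewrite ?inE negb_or => /andP[/andP[ve vZ] clv].
    rewrite vZ /= cardsU1 vZ cZ add1n eqxx /= /extends setUCA clv andbT.
    by rewrite disjoint_sym disjoints_subset subUset sub1set inE ve -disjoints_subset disjoint_sym.
  move: cC; rewrite -(ler_nat R) natrD => cC bl.
  have : (((#|e| + t) * (#|e| + t) ^ k.-2)%:R * d * #|T|%:R) <= b * d * #|T|%:R.
    rewrite -!mulrA ler_wpM2r ?mulr_ge0 ?ler0n //; apply: le_trans bt.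
    rewrite -expnS ler_nat (_ : k.-2.+1 = k.-1); last lia.
    by rewrite leq_exp2r; lia.
  move: cC bl; rewrite mulrBr mulr1 (mulrC #|T|%:R); lra.
rewrite factS mulnC natrM -mulrA -natrM.
apply: (le_trans _ (ler_wpM2l (ler0n R t`!) stepE)); rewrite [leRHS]mulrA.
have x1 : 0 <= #|T|%:R * (1 - b * d) by rewrite mulr_ge0 ?ler0n ?subr_ge0.
apply: (le_trans _ (ler_wpM2r x1 IHt)).
rewrite exprSr -[leLHS]mulrA -[leRHS]mulrA ler_wpM2l ?exprn_ge0 ?ler0n //
  [leRHS]mulrCA ler_wpM2l ?ler0n //.
have bd0 : 0 <= b * d by rewrite mulr_ge0.
(* This is the term dropped in [(1 - t * x) * (1 - x) >= 1 - (t + 1) * x] for [x = b * d]. *)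
have : 0 <= t%:R * (b * d) * (b * d) by rewrite !mulr_ge0 ?ler0n.
rewrite mulrDl ?mulrBr -natr1; lra.
Qed.

(** Remove a vertex [v] from a [(t+1)]-clique that does not extend [e], leaving a clique [Z]. Either
    [Z] already fails to extend [e], or [v] is blocked for [P = e :|: Z] with [Y = e]. Since
    [v |: Z] is a clique, only missing edges that meet [e] count, whence the factor [#|e|] in
    [b]. *)
Lemma card_nonextensions_le e (t : nat) (b : R) : 0 <= b ->
  clique e -> (k.-1 <= #|e|)%N -> (#|e| * (#|e| + t.-1) ^ k.-2)%:R <= b ->
  t`!%:R * #|nonextensions e t|%:R <= t%:R * (b * d) * #|T|%:R ^+ t.
Proof.
move=> b0 cle ke.
elim: t => [|t IHt] bt.
  rewrite !mul0r (_ : nonextensions e 0 = set0) ?cards0 ?mulr0 //.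
  apply/setP => Z; rewrite !inE cards_eq0; case: eqP => //= ->.
  by rewrite /extends setU0 cle -setI_eq0 setI0 eqxx andbF.
have {}IHt : t`!%:R * #|nonextensions e t|%:R <= t%:R * (b * d) * #|T|%:R ^+ t.
  apply: IHt; apply: le_trans bt; rewrite ler_nat leq_mul2l; apply/orP; right.
  case: k k_ge2 => [|[|[|?]]] // _; rewrite leq_exp2r //; lia.
have stepE : (t.+1 * #|nonextensions e t.+1|)%:R <=
    #|nonextensions e t|%:R * #|T|%:R + #|extensions e t|%:R * (b * d * #|T|%:R).
  rewrite (@card_pairs _ _ t); last by move=> A; rewrite inE => /andP[/eqP].
  rewrite natr_sum (bigID (fun Z : {set T} => extends e Z)) /= addrC; apply: lerD.
    rewrite [leRHS]mulr_natl -[leRHS]sumr_const.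
    rewrite (bigID (fun Z : {set T} => clique Z)) /= [X in _ + X]big1 ?addr0; last first.
      move=> Z /andP[_ ncl]; apply/eqP; rewrite pnatr_eq0 cards_eq0; apply/eqP/setP => v.
      rewrite !inE; apply: contraNF ncl => /and4P[_ _ cl _].
      by apply: sub_clique cl; apply: subsetUr.
    rewrite (eq_bigl (fun Z : {set T} => Z \in nonextensions e t)); last first.
      by move=> Z; rewrite inE -andbA (andbC (clique Z)).
    by apply: ler_sum => Z _; rewrite ler_nat max_card.
  rewrite [leRHS]mulr_natl -[leRHS]sumr_const.
  rewrite (eq_bigl (fun Z : {set T} => Z \in extensions e t)); last by move=> Z; rewrite inE.
  apply: ler_sum => Z; rewrite inE => /andP[/eqP cZ /andP[dis cl]].
  have cU : #|e :|: Z| = (#|e| + t)%N.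
    by move: dis; rewrite cardsU cZ -setI_eq0 => /eqP ->; rewrite cards0 subn0.
  have ZE : (e :|: Z) :\: e = Z.
    by rewrite setDUl setDv set0U; apply/setDidPl; rewrite disjoint_sym.
  apply: le_trans (_ : #|blocked (e :|: Z) e|%:R <= _).
    rewrite ler_nat; apply/subset_leq_card/subsetP => v; rewrite !inE.
    case/andP=> vZ /and3P[_ clv next]; have := ZE; move/setP/(_ v); rewrite !inE => ->.
    rewrite vZ ZE clv /=; apply: contra next => /andP[].
    rewrite negb_or => /andP[ve _] clU.
    by rewrite /extends setUCA clU andbT disjoint_sym
      disjoints_subset subUset sub1set inE ve -disjoints_subset disjoint_sym.
  apply: le_trans (card_blocked cl (subsetUl _ _) ke) _.
  by rewrite -!mulrA ler_wpM2r ?mulr_ge0 ?ler0n // cU.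
rewrite factS mulnC natrM -mulrA -natrM.
apply: (le_trans (ler_wpM2l (ler0n R t`!) stepE)); rewrite mulrDr !mulrA.
have := ler_wpM2r (ler0n R #|T|) IHt.
have bd0 : 0 <= b * d * #|T|%:R by rewrite !mulr_ge0 ?ler0n.
have := fact_mul_card_extensions_le e t; rewrite -(ler_nat R) natrM natrX.
move=> /(ler_wpM2r bd0) h1 h2.
rewrite -natr1 exprSr; lra.
Qed.

End CliqueCounting.

(** * The corrected clique weights *)

Section CliqueWeighting.

Variables (R : realFieldType) (T : finType) (E : {set {set T}}) (k r : nat) (d : R).
Hypothesis k_ge2 : (2 <= k)%N.
Hypothesis lt_kr : (k < r)%N.
Hypothesis E_uniform : {in E, forall e : {set T}, #|e| = k}.
Hypothesis d_ge0 : 0 <= d.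
Hypothesis d_small : d * (2 ^+ (k + 3) * k%:R ^+ 2 * r%:R ^+ (2 * k - 1)) <= k`!%:R.
Hypothesis few_nonneighbours :
  forall S : {set T}, #|S| = k.-1 -> #|nonneighbours E S|%:R <= d * #|T|%:R.

Let clq := clique E k.
(** For an edge [e] this is, by [card_extensions], the number of [(k + r)]-cliques [Q] through [e]
    over which its correction is averaged. *)
Let D e := #|extensions E k e r|.
Let bad e := #|nonextensions E k e (r - k)|.

Let r_gt0 : 0 < r%:R :> R. Proof. by rewrite ltr0n; lia. Qed.
Let k_gt0 : 0 < k%:R :> R. Proof. by rewrite ltr0n; lia. Qed.

Let d_small' :
  d * 2 ^+ k * 8%:R * k%:R ^+ 2 * r%:R ^+ k * r%:R ^+ k.-1 <= k`!%:R.
Proof.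
apply: le_trans d_small; rewrite le_eqVlt; apply/orP; left; apply/eqP.
rewrite exprD (_ : (2 * k - 1 = k + k.-1)%N); last lia.
rewrite exprD; ring.
Qed.

(** In [card_extensions_ge] with [t = r] and [b = (2 * r) ^ k.-1], at most half of the main term is
    lost. The bound on [d] yields this after cancelling [r ^ k.-1] by means of
    [k! <= k * r ^ k.-1]. *)
Let extension_loss : r%:R * (((2 * r) ^ k.-1)%:R * d) <= 2^-1.
Proof.
have fact_le : k`!%:R <= k%:R * r%:R ^+ k.-1 :> R.
  rewrite -natrX -natrM ler_nat.
  apply: leq_trans (_ : k * k ^ k.-1 <= _)%N; last first.
    by rewrite leq_mul2l leq_exp2r ?(ltnW lt_kr) ?orbT //; lia.
  by rewrite -expnS prednK ?(ltnW k_ge2) // -ffactnn leq_ffact_expn.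
have x_gt0 : 0 < r%:R ^+ k.-1 :> R by rewrite exprn_gt0.
have -> : r%:R * (((2 * r) ^ k.-1)%:R * d) = d * 2 ^+ k * r%:R ^+ k / 2%:R.
  rewrite natrX natrM exprMn -[in RHS](ltn_predK k_ge2) !exprS; by field.
have le_y := le_trans d_small' fact_le; move: le_y; set x := r%:R ^+ k.-1 in x_gt0 *.
set y := d * 2 ^+ k * r%:R ^+ k.
rewrite (_ : d * 2 ^+ k * _ * _ * _ * _ = (y * 8%:R * k%:R) * (k%:R * x)); last by rewrite /y; ring.
move=> le_y; have y8 : y * 8%:R * k%:R <= 1 by rewrite ger_pMl ?mulr_gt0 in le_y.
have y0 : 0 <= y by rewrite /y !mulr_ge0 ?exprn_ge0 ?ler0n.
have k1 : 1 <= k%:R :> R by rewrite ler1n ltnW.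
have : y * 8%:R <= y * 8%:R * k%:R by rewrite ler_peMr // mulr_ge0 ?ler0n.
lra.
Qed.

Let edge_clique e : e \in E -> clq e.
Proof.
move=> eE; apply/cliqueP => F Fe cF; rewrite (_ : F = e) //.
by apply/eqP; rewrite eqEcard Fe cF (E_uniform eE) /=.
Qed.

Let D_ge e : e \in E -> #|T|%:R ^+ r <= 2%:R * r`!%:R * (D e)%:R :> R.
Proof.
move=> eE; have ce := E_uniform eE.
have bd : ((2 * r) ^ k.-1)%:R * d <= 1.
  have := extension_loss; have : 1 <= r%:R :> R by rewrite ler1n; lia.
  have : 0 <= ((2 * r) ^ k.-1)%:R * d by rewrite mulr_ge0.
  nra.
have := @card_extensions_ge R T E k k_ge2 E_uniform d d_ge0 few_nonneighbours e r
  ((2 * r) ^ k.-1)%:R (ler0n _ _) bd (edge_clique eE).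
rewrite ce => /(_ (leq_pred k)).
have le_2r : (k + r <= 2 * r)%N by rewrite mul2n -addnn leq_add2r ltnW.
have k1_gt0 : (0 < k.-1)%N by rewrite -ltnS prednK // ltnW.
rewrite ler_nat leq_exp2r // => /(_ le_2r).
have := ler_wpM2l (exprn_ge0 r (ler0n R #|T|)) extension_loss.
rewrite mulrBr mulr1 -/(D e); set x := _ ^+ r; set y := x * (_ * _).
rewrite -[X in X <= _]/y; lra.
Qed.

Let D_gt0 e : e \in E -> 0 < (D e)%:R :> R.
Proof.
move=> eE; have cT : (0 < #|T|)%N.
  by apply: leq_trans (max_card e); rewrite (E_uniform eE) (ltnW k_ge2).
have n_gt0 : 0 < #|T|%:R ^+ r :> R by rewrite exprn_gt0 ?ltr0n.
have := lt_le_trans n_gt0 (D_ge eE).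
by rewrite pmulr_rgt0 ?ltr0n // mulr_gt0 ?ltr0n ?fact_gt0.
Qed.

(** Divide the bound of [card_nonextensions_le] on [bad e] by that of [D_ge] on [D e]: the
    factorials combine to [r ^_ k], the factor 2 comes from [D_ge], and [n ^ k] remains in the
    denominator. *)
Let rho : R := 2%:R * (r ^_ k)%:R * (k%:R * r%:R ^+ k.-1) * d.

(** The form needed in [norm_correction]: [2 ^ k] comes from [sum_norm_gadget_coef], and [k!] from
    counting the sets [Q] around a given [K]. *)
Let rho_small : rho * 2 ^+ k <= k`!%:R.
Proof.
apply: le_trans d_small'.
have le_ff : (r ^_ k)%:R <= r%:R ^+ k :> R by rewrite -natrX ler_nat leq_ffact_expn.
set z := d * 2 ^+ k * r%:R ^+ k.-1 * k%:R.
have z0 : 0 <= z by rewrite !mulr_ge0 ?exprn_ge0 ?ler0n.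
rewrite (_ : rho * _ = z * (2%:R * (r ^_ k)%:R)); last by rewrite /rho /z; ring.
rewrite [leRHS](_ : _ = z * (8%:R * k%:R * r%:R ^+ k)); last by rewrite /z; ring.
rewrite ler_wpM2l // ler_pM ?ler0n //; have : 1 <= k%:R :> R by rewrite ler1n ltnW.
lra.
Qed.

Let bad_le e : e \in E -> (bad e)%:R / (D e)%:R <= rho / #|T|%:R ^+ k.
Proof.
move=> eE; have ce := E_uniform eE.
have n_gt0 : 0 < #|T|%:R ^+ k :> R.
  by rewrite exprn_gt0 // ltr0n; apply: leq_trans (max_card e); rewrite ce (ltnW k_ge2).
rewrite ler_pdivrMr ?D_gt0 // mulrAC ler_pdivlMr //.
have f_gt0 : 0 < (r - k)`!%:R :> R by rewrite ltr0n fact_gt0.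
rewrite -(ler_pM2l f_gt0) mulrA.
(* The clique has at most [k + (r - k) - 1 < r] vertices before the last one is adjoined. *)
have b_ge : (#|e| * (#|e| + (r - k).-1) ^ k.-2)%:R <= (k * r ^ k.-2)%:R :> R.
  rewrite ce ler_nat leq_mul2l; apply/orP; right.
  by case: (k.-2) => [|j] //; rewrite leq_exp2r //; move: lt_kr; clear; lia.
have := @card_nonextensions_le R T E k k_ge2 E_uniform d d_ge0 few_nonneighbours e (r - k)
  _ (ler0n _ _) (edge_clique eE) _ b_ge.
rewrite ce => /(_ (leq_pred k)).
move/(ler_wpM2r (ltW n_gt0)) => h; apply: le_trans h _.
rewrite -[leLHS]mulrA -exprD subnK ?(ltnW lt_kr) //.
have c0 : 0 <= (k * r ^ k.-2)%:R * d by rewrite mulr_ge0 ?ler0n.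
apply: (@le_trans _ _ (r%:R * ((k * r ^ k.-2)%:R * d) * #|T|%:R ^+ r)).
  by rewrite !ler_wpM2r ?exprn_ge0 ?ler0n // ler_nat leq_subr.
apply: le_trans (ler_wpM2l _ (D_ge eE)) _; first by rewrite mulr_ge0 ?ler0n.
rewrite /rho -(ffact_fact (ltnW lt_kr)) !natrM natrX.
rewrite (_ : r%:R ^+ k.-1 = r%:R * r%:R ^+ k.-2); last first.
  by rewrite -exprS; case: (k) k_ge2 => [|[|?]].
by rewrite le_eqVlt; apply/orP; left; apply/eqP; ring.
Qed.

Let A := #|[set Z : {set T} | (#|Z| == r - k)%N && clq Z]|.

Let A_gt0 e : e \in E -> 0 < A%:R :> R.
Proof.
move=> eE; have := D_gt0 eE; rewrite !ltr0n => /card_gt0P[Z].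
rewrite inE => /andP[/eqP cZ /andP[_ cl]].
have : (0 < #|[set B : {set T} | B \subset Z & #|B| == (r - k)%N]|)%N.
  by rewrite cards_draws bin_gt0 cZ leq_subr.
case/card_gt0P => B; rewrite inE => /andP[BZ cB]; apply/card_gt0P; exists B.
by rewrite inE cB; apply: sub_clique cl; apply: subset_trans BZ _; apply: subsetUr.
Qed.

(** The total correction on [K], multiplied by [A]; this scaling makes the bound to prove equal to
    1. *)
Let correction (K : {set T}) : R :=
  \sum_(e in E) (bad e)%:R / (D e)%:R *
    \sum_(Q : {set T} | [&& clq Q, e \subset Q & #|Q| == (k + r)%N] && (K \subset Q))
       gadget_coef R r k #|e :\: K|.

(** Sum over the cliques [Q] around [K] first: each carries at most [2 ^ k] in absolute gadget
    weight, there are at most [n ^ k / k!] of them, and every quotient [bad e / D e] is at most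
    [rho / n ^ k]. *)
Let norm_correction (K : {set T}) : #|K| = r -> `|correction K| <= 1.
Proof.
move=> cK.
(* An edge is used to see that [#|T|] is positive. *)
have [E0|[e0 e0E]] := set_0Vmem E.
  by rewrite /correction E0 big_set0 normr0.
have n_gt0 : 0 < #|T|%:R ^+ k :> R.
  by rewrite exprn_gt0 // ltr0n; apply: leq_trans (max_card e0); rewrite E_uniform // (ltnW k_ge2).
have rho0 : 0 <= rho by rewrite !mulr_ge0 ?exprn_ge0 ?ler0n.
pose QK : {set {set T}} := [set Q : {set T} | [&& clq Q, #|Q| == (k + r)%N & K \subset Q]].
apply: (@le_trans _ _ (\sum_(e in E) rho / #|T|%:R ^+ k *
    \sum_(Q in QK | e \subset Q) `|gadget_coef R r k #|e :\: K| |)).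
  apply: le_trans (ler_norm_sum _ _ _) _; apply: ler_sum => e eE.
  rewrite normrM ger0_norm ?divr_ge0 ?ler0n //.
  apply: ler_pM; rewrite ?divr_ge0 ?ler0n ?normr_ge0 ?bad_le //.
  apply: le_trans (ler_norm_sum _ _ _) _; rewrite le_eqVlt; apply/orP; left; apply/eqP.
  apply: eq_bigl => Q; rewrite inE.
  by case: (clq Q); case: (e \subset Q); case: (K \subset Q); rewrite ?andbF ?andbT.
rewrite -mulr_sumr (exchange_big_dep (fun Q => Q \in QK)) /=; last by move=> e Q _ /andP[].
apply: (@le_trans _ _ (rho / #|T|%:R ^+ k * (2 ^+ k * #|QK|%:R))).
  rewrite ler_wpM2l ?divr_ge0 ?(ltW n_gt0) // mulr_natr -[leRHS]sumr_const.
  apply: ler_sum => Q; rewrite inE => /and3P[clQ /eqP cQ KQ].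
  rewrite addnC in cQ; apply: le_trans (sum_norm_gadget_coef R lt_kr KQ cK cQ).
  rewrite [leRHS](bigID (fun e => e \in E)) /= -[leLHS]addr0 lerD //; last first.
    by apply: sumr_ge0 => e _; apply: normr_ge0.
  rewrite le_eqVlt; apply/orP; left; apply/eqP; apply: eq_bigl => e.
  case: (boolP (e \in E)) => eE; last by rewrite !andbF.
  by rewrite (E_uniform eE) clQ addnC cQ KQ !eqxx !andbT.
have QK_le : k`!%:R * #|QK|%:R <= #|T|%:R ^+ k :> R.
  rewrite -natrX -natrM ler_nat; apply: (@fact_mul_card_supsets_le _ K k QK) => Q.
  by rewrite inE cK addnC => /and3P[_ /eqP -> ->].
have f_gt0 : 0 < k`!%:R :> R by rewrite ltr0n fact_gt0.
rewrite [leLHS](_ : _ = (rho * 2 ^+ k) * #|QK|%:R / #|T|%:R ^+ k); last by ring.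
rewrite ler_pdivrMr // mul1r; apply: le_trans QK_le.
by rewrite ler_wpM2r ?ler0n.
Qed.

(** After exchanging the sums, [sum_gadget_coef] leaves only [e = f], where each of the [D f]
    cliques [Q] through [f] contributes [bad f / D f]. *)
Let sum_correction f : f \in E ->
  \sum_(K : {set T} | [&& clq K, f \subset K & #|K| == r]) correction K = (bad f)%:R.
Proof.
move=> fE; have cf := E_uniform fE.
have inner e Q : e \in E -> clq Q -> e \subset Q -> #|Q| = (r + k)%N ->
    \sum_(K : {set T} | [&& clq K, f \subset K & #|K| == r] && (K \subset Q))
      gadget_coef R r k #|e :\: K| = (e == f)%:R.
  move=> eE clQ eQ cQ; case: (boolP (f \subset Q)) => fQ; last first.
    rewrite big1 => [|K /andP[/and3P[_ fK _] KQ]]; last first.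
      by rewrite (subset_trans fK KQ) in fQ.
    by case: eqP => // ef; rewrite -ef eQ in fQ.
  rewrite -(sum_gadget_coef R lt_kr eQ fQ (E_uniform eE) cf cQ); apply: eq_bigl => K.
  (* A subset of the clique [Q] is itself a clique, so the condition [clq K] costs nothing. *)
  case: (boolP (K \subset Q)) => KQ; last by rewrite !andbF.
  by rewrite /clq (sub_clique KQ clQ) /= andbT.
rewrite /correction exchange_big /= (bigD1 f) //= [X in _ + X]big1 ?addr0 => [|e /andP[eE ef]].
  rewrite -mulr_sumr (exchange_big_dep
    (fun Q => [&& clq Q, f \subset Q & #|Q| == (k + r)%N])) /=; last by move=> ? ? _ /andP[].
  rewrite (eq_bigr (fun=> 1)) => [|Q /and3P[clQ fQ /eqP cQ]]; last first.
    under eq_bigl => K do rewrite clQ fQ cQ eqxx /=.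
    by rewrite inner // ?eqxx // cQ addnC.
  rewrite (_ : \sum_(_ | _) _ = (D f)%:R) ?divfK ?lt0r_neq0 ?D_gt0 //.
  rewrite /D card_extensions cf -sum1_card natr_sum.
  by apply: eq_bigl => Q; rewrite inE.
rewrite -mulr_sumr (exchange_big_dep
  (fun Q => [&& clq Q, e \subset Q & #|Q| == (k + r)%N])) /=; last by move=> ? ? _ /andP[].
rewrite big1 ?mulr0 // => Q /and3P[clQ eQ /eqP cQ].
under eq_bigl => K do rewrite clQ eQ cQ eqxx /=.
by rewrite inner // ?(negPf ef) // cQ addnC.
Qed.

(** The weight is [(1 + correction K) / A]. At an edge [f] the constant terms count the extensions
    of [f] and the corrections add [bad f]; by [card_cliques] these make up [A]. *)
Lemma clique_weighting : exists w : {set T} -> R,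
  (forall K : {set T}, #|K| = r -> 0 <= w K) /\
  {in E, forall f : {set T},
    \sum_(K : {set T} | [&& clique E k K, f \subset K & #|K| == r]) w K = 1}.
Proof.
exists (fun K => A%:R^-1 * (1 + correction K)); split=> [K cK|f fE].
  rewrite mulr_ge0 ?invr_ge0 ?ler0n //; have := norm_correction cK.
  by rewrite ler_norml => /andP[]; lra.
rewrite -mulr_sumr big_split /= sum_correction //.
rewrite (_ : \sum_(_ | _) 1 = #|extensions E k f (r - k)|%:R); last first.
  rewrite card_extensions (E_uniform fE) subnKC ?(ltnW lt_kr) // -sum1_card natr_sum.
  by apply: eq_bigl => K; rewrite inE.
by rewrite -natrD -card_cliques mulVf // lt0r_neq0 // (A_gt0 fE).
Qed.

End CliqueWeighting.

(** * From cliques and nonneighbours to copies and codegrees *)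

(** A copy of the complete hypergraph is determined by its vertex set, so a weighting of [r]-cliques
    is a weighting of copies. Conversely, any enumeration of an [r]-clique is an embedding. *)
Lemma mem_copies_complete (k r : nat) (G : uhypergraph k)
    (H : {set vertex G} * {set {set vertex G}}) :
  H \in copies (complete k r) G =
  [&& clique (edges G) k H.1, #|H.1| == r
    & H.2 == [set e : {set vertex G} | (e \subset H.1) && (#|e| == k)]].
Proof.
rewrite inE; apply/andP/and3P => [[HG /existsP[f /and3P[/injectiveP f_inj /eqP H1 /eqP H2]]]|
    [cl /eqP c1 /eqP H2]].
  have H2E : H.2 = [set e : {set vertex G} | (e \subset H.1) && (#|e| == k)].
    rewrite H2; apply/setP => e; rewrite inE; apply/imsetP/andP => [[F]|[eH ce]].
      rewrite inE => /eqP cF ->; rewrite card_imset // cF; split=> //.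
      by rewrite H1; apply: imsetS; apply/subsetP.
    have eE : e = [set f x | x in f @^-1: e].
      apply/setP => z; apply/idP/imsetP => [ze|[x]]; last by rewrite inE => xe ->.
      have /imsetP[x _ zx] : z \in [set f x | x : vertex (complete k r)].
        by rewrite -H1; apply: (subsetP eH).
      by exists x => //; rewrite inE -zx.
    exists (f @^-1: e) => //.
    by rewrite inE -(card_imset _ f_inj) -eE.
  split; last by rewrite H2E.
    apply/cliqueP => F FH cF; apply: (subsetP HG).
    by rewrite H2E inE FH cF eqxx.
  by rewrite H1 card_imset // cardT -cardE card_ord.
split.
  by apply/subsetP => e; rewrite H2 inE => /andP[eH /eqP]; move/cliqueP: cl; apply.
pose g (x : 'I_r) := enum_val (cast_ord (esym c1) x).
have g_inj : injective g by move=> x y /enum_val_inj /cast_ord_inj.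
have g_mem x : g x \in H.1 by apply: enum_valP.
have g_onto z : z \in H.1 -> exists x, z = g x.
  move=> zH; exists (cast_ord c1 (enum_rank_in zH z)).
  by rewrite /g cast_ordK enum_rankK_in.
have fg_inj : injective (finfun g) by move=> x y; rewrite !ffunE; apply: g_inj.
apply/existsP; exists (finfun g); apply/and3P; split.
- exact/injectiveP.
- apply/eqP/setP => z; apply/idP/imsetP => [/g_onto[x ->]|[x _ ->]]; last by rewrite ffunE.
  by exists x => //; rewrite ffunE.
rewrite H2; apply/eqP/setP => e; rewrite inE; apply/andP/imsetP => [[eH ce]|[F]].
  have eE : e = [set finfun g x | x in g @^-1: e].
    apply/setP => z; apply/idP/imsetP => [ze|[x]]; last by rewrite inE ffunE => xe ->.
    have [x zx] := g_onto z (subsetP eH z ze).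
    by exists x; rewrite ?inE ?ffunE -?zx.
  exists (g @^-1: e) => //.
  by rewrite inE -(card_imset _ fg_inj) -eE.
rewrite inE => /eqP cF ->; rewrite card_imset // cF.
split=> //; apply/subsetP => z /imsetP[x _ ->]; rewrite ffunE; exact: g_mem.
Qed.

(** The edges through [S] are the sets [v |: S] in [edges G], and uniformity forces [v] outside [S],
    so each comes from a single [v]. *)
Lemma card_nonneighbours (k : nat) (G : uhypergraph k) (S : {set vertex G}) :
  (0 < k)%N -> #|S| = k.-1 ->
  (#|nonneighbours (edges G) S| + codegree S)%N = #|vertex G|.
Proof.
move=> k_gt0 cS; rewrite addnC -[RHS](cardsC [set v | v |: S \in edges G]).
congr (_ + _)%N; last by apply: eq_card => v; rewrite !inE.
rewrite -(card_in_imset (f := fun v => v |: S)) => [|u v]; last first.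
  rewrite !inE => /edges_uniform; rewrite cardsU1 cS => cu _ uv.
  have uS : u \notin S by move: cu; case: (u \in S) => //=; lia.
  by have := setU11 u S; rewrite uv !inE (negPf uS) orbF => /eqP.
apply: eq_card => e; rewrite inE; apply/andP/imsetP => [[eG Se]|[v]]; last first.
  by rewrite inE => vG ->; split=> //; apply: subsetUr.
have ce := edges_uniform eG.
have /cards1P[v Ev] : #|e :\: S| == 1%N by rewrite cardsD (setIidPr Se) ce cS; lia.
have eE : e = v |: S by rewrite -[LHS](setID e S) (setIidPr Se) Ev setUC.
by exists v; rewrite ?inE -eE.
Qed.

Theorem theorem1p5 (R : realType) (r k n : nat) (delta : R)
    (hk : (2 <= k)%N) (hr : (k < r)%N)
    (hdelta : delta =
       (k`!)%:R / (2 ^+ (k + 3) * k%:R ^+ 2 * r%:R ^+ (2 * k - 1)))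
    (hn : 1 / delta < n%:R)
    (G : uhypergraph k) (hG : #|vertex G| = n)
    (hcodeg : (1 - delta) * n%:R <= (min_codegree G)%:R) :
  exists w : {set vertex G} * {set {set vertex G}} -> R,
    fractional_decomposition (complete k r) w.
Proof.
have den_gt0 : 0 < 2 ^+ (k + 3) * k%:R ^+ 2 * r%:R ^+ (2 * k - 1) :> R.
  by rewrite !mulr_gt0 ?exprn_gt0 ?ltr0n //; lia.
have delta_ge0 : 0 <= delta by rewrite hdelta divr_ge0 ?ler0n ?ltW.
have [|S cS|w [w_ge0 w_sum]] := @clique_weighting R (vertex G) (edges G) k r delta hk hr
    (@edges_uniform k G) delta_ge0.
(* The smallness condition holds with equality for this [delta]. *)
- by rewrite hdelta divfK ?lt0r_neq0.
- have hS : (min_codegree G <= codegree S)%N.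
    by apply: leq_minn_big; rewrite cS.
  have := card_nonneighbours (ltnW hk) cS; rewrite hG => /(congr1 (GRing.natmul (1 : R))).
  rewrite natrD; move: hS; rewrite -(ler_nat R); lra.
pose ksub (K : {set vertex G}) := [set e : {set vertex G} | (e \subset K) && (#|e| == k)].
have sumE f : f \in edges G -> \sum_(H in copies (complete k r) G | f \in H.2) w H.1 = 1.
  move=> fE; rewrite -(w_sum f fE).
  (* The sum over copies becomes a sum over their vertex sets. *)
  rewrite (reindex_onto (fun K => (K, ksub K)) (fun H => H.1)) /=; last first.
    move=> [K X] /andP[]; rewrite mem_copies_complete /= => /and3P[_ _ /eqP ->] _ //.
  apply: eq_bigl => K; rewrite mem_copies_complete /= !eqxx !andbT inE.
  by rewrite (edges_uniform fE) eqxx andbT andbAC -andbA.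
have w_ge0' H : H \in copies (complete k r) G -> 0 <= w H.1.
  by rewrite mem_copies_complete => /and3P[_ /eqP cH _]; apply: w_ge0.
exists (fun H => w H.1); split=> // H HG; rewrite w_ge0' //=.
have := HG; rewrite mem_copies_complete => /and3P[/cliqueP cl /eqP c1 /eqP H2].
(* As [k < r], the copy has an edge [f]; its weight is one of the nonnegative terms that add up to 1
   at [f], hence at most 1. *)
have : (0 < #|H.2|)%N by rewrite H2 cards_draws bin_gt0 c1 ltnW.
case/card_gt0P => f fH.
have fE : f \in edges G by move: fH; rewrite H2 inE => /andP[fs /eqP]; apply: cl.
rewrite -(sumE f fE) (bigD1 H) ?HG //= lerDl; apply: sumr_ge0 => H' /andP[/andP[H'G _] _].
exact: w_ge0'.
Qed.
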